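(* For every consistent $S\subseteq\mathrm{Sent}_{\mathcal{L}_\mathrm{Tr}}$: $\mathrm{SSK}(S)=S$ if and only if $(\mathbb{N},S)\vDash\mathrm{PK}$.
   Context: $\mathcal{L}_\mathrm{Tr}$ is the language of PA (extended with finitely many primitive recursive function symbols, including syntactic operations on codes $\dot\neg,\dot\vee,\dot\wedge,\dot\forall,\dot\exists,\dot\rightarrow$, $\dot{\mathrm{Tr}}$, substitution $y(t/v)$) plus a unary predicate $\mathrm{Tr}$; $\mathrm{Sent}_{\mathcal{L}_\mathrm{Tr}}$ is the set of codes of sentences, represented by $\mathrm{Sent}(x)$; $\mathrm{PAT}$ is PA in $\mathcal{L}_\mathrm{Tr}$ with full induction; $\mathrm{Pr}_{\mathrm{PAT}}$ a standard provability predicate; $\#\varphi$ the code and $\ulcorner\varphi\urcorner$ its numeral; $t$ ranges over codes of closed terms, $t^\circ$ is the value; $\ulcorner\pi(\dot y)\urcorner$ is the code of $\pi$ applied to the numeral of $y$; $\mathrm{True}_0$ is the set (formula) of codes of true $\mathcal{L}_\mathbb{N}$-literals. $S$ is consistent if no $\varphi$ has $\#\varphi,\#\neg\varphi\in S$. For $X\subseteq\omega$, $X^-=\{\#\varphi:\#\neg\varphi\in X\}\cup\{n:n\notin\mathrm{Sent}_{\mathcal{L}_\mathrm{Tr}}\}$; $X\vDash_{\mathrm{sk}}\varphi$ means $\varphi$ is true in Strong Kleene evaluation over the standard model with $\mathrm{Tr}(t)$ true iff $t^\circ\in X$ and false iff $t^\circ\in X^-$. For consistent $X$, $\mathrm{SSK}(X)=\{\#\varphi:\exists\psi(X\vDash_{\mathrm{sk}}\psi\text{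 and }\mathrm{PAT}\vdash\psi\rightarrow\varphi)\}$. $\pi(x)$ is a formula obtained by the diagonal lemma such that $\mathrm{PAT}$ proves $\pi(x)$ equivalent to the disjunction of: $\mathrm{True}_0(x)$; $\exists t(x=\dot{\mathrm{Tr}}\,t\wedge\mathrm{Tr}(t^\circ))$; $\exists t(x=\dot\neg\dot{\mathrm{Tr}}\,t\wedge(\mathrm{Tr}(\dot\neg t^\circ)\vee\neg\mathrm{Sent}(t^\circ)))$; $\exists y(x=\dot\neg\dot\neg y\wedge\mathrm{Tr}\ulcorner\pi(\dot y)\urcorner)$; $\exists y,z(x=y\dot\wedge z\wedge\mathrm{Tr}\ulcorner\pi(\dot y)\urcorner\wedge\mathrm{Tr}\ulcorner\pi(\dot z)\urcorner)$; $\exists y,z(x=\dot\neg(y\dot\wedge z)\wedge(\mathrm{Tr}\ulcorner\pi(\dot\neg\dot y)\urcorner\vee\mathrm{Tr}\ulcorner\pi(\dot\neg\dot z)\urcorner))$; $\exists y,z(x=y\dot\vee z\wedge(\mathrm{Tr}\ulcorner\pi(\dot y)\urcorner\vee\mathrm{Tr}\ulcorner\pi(\dot z)\urcorner))$; $\exists y,z(x=\dot\neg(y\dot\vee z)\wedge\mathrm{Tr}\ulcorner\pi(\dot\neg\dot y)\urcorner\wedge\mathrm{Tr}\ulcorner\pi(\dot\neg\dot z)\urcorner)$; $\exists y,v(x=\dot\forall vy\wedge\forall t\,\mathrm{Tr}\ulcorner\pi(\dot y(t/v))\urcorner)$; $\exists y,v(x=\dot\neg\dot\forall vy\wedge\exists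 t\,\mathrm{Tr}\ulcorner\pi(\dot\neg\dot y(t/v))\urcorner)$; $\exists y,v(x=\dot\exists vy\wedge\exists t\,\mathrm{Tr}\ulcorner\pi(\dot y(t/v))\urcorner)$; $\exists y,v(x=\dot\neg\dot\exists vy\wedge\forall t\,\mathrm{Tr}\ulcorner\pi(\dot\neg\dot y(t/v))\urcorner)$. $\mathrm{PK}$ is the theory consisting of $\mathrm{PAT}$ together with ($\mathrm{TB}\pi$) $\forall x(\mathrm{Tr}\ulcorner\pi(\dot x)\urcorner\leftrightarrow\pi(x))$ and ($\mathrm{PK}$-$\mathrm{Tr}$) $\forall x(\mathrm{Tr}(x)\leftrightarrow\exists y(\pi(y)\wedge\mathrm{Pr}_{\mathrm{PAT}}(y\dot\rightarrow x)))$. *)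

(* Defs.v *)
From Stdlib Require Import Arith Bool List Cantor.
Import ListNotations.

Inductive fun1 := Fsucc | Fneg | FTr | Fnum.
Inductive fun2 := Fadd | Fmul | Fpair | Fand | For | Fimp | Fall | Fex.
Inductive fun3 := Fsub.

Inductive term :=
| Var (n : nat)
| Zero
| App1 (f : fun1) (t : term)
| App2 (f : fun2) (t1 t2 : term)
| App3 (f : fun3) (t1 t2 t3 : term).

(* The arithmetical language is the [Tr]-free part; it contains all the
   function symbols. *)
Inductive formula :=
| Eq (t1 t2 : term)
| Tr (t : term)
| Neg (phi : formula)
| And (phi psi : formula)
| Or (phi psi : formula)
| All (v : nat) (phi : formula)
| Ex (v : nat) (phi : formula).

Definition Imp (phi psi : formula) : formula := Or (Neg phi) psi.
Definition Iff (phi psi : formula) : formula := And (Imp phi psi) (Imp psi phi).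

Fixpoint arithmetical (phi : formula) : bool :=
  match phi with
  | Eq _ _ => true
  | Tr _ => false
  | Neg phi => arithmetical phi
  | And phi psi | Or phi psi => arithmetical phi && arithmetical psi
  | All _ phi | Ex _ phi => arithmetical phi
  end.

Fixpoint occurs (v : nat) (t : term) : bool :=
  match t with
  | Var n => v =? n
  | Zero => false
  | App1 _ t => occurs v t
  | App2 _ t1 t2 => occurs v t1 || occurs v t2
  | App3 _ t1 t2 t3 => occurs v t1 || occurs v t2 || occurs v t3
  end.

Fixpoint free (v : nat) (phi : formula) : bool :=
  match phi with
  | Eq t1 t2 => occurs v t1 || occurs v t2
  | Tr t => occurs v t
  | Neg phi => free v phi
  | And phi psi | Or phi psi => free v phi || free v psi
  | All w phi | Ex w phi => negb (v =? w) && free v phi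
  end.

Definition closed (t : term) : Prop := forall v, occurs v t = false.
Definition sentence (phi : formula) : Prop := forall v, free v phi = false.

(* [tsubst s v t] and [fsubst s v phi] replace the free occurrences of the
   variable [v] by [s], without renaming; [free_for] says that this causes no
   capture. *)
Fixpoint tsubst (s : term) (v : nat) (t : term) : term :=
  match t with
  | Var n => if v =? n then s else Var n
  | Zero => Zero
  | App1 f t => App1 f (tsubst s v t)
  | App2 f t1 t2 => App2 f (tsubst s v t1) (tsubst s v t2)
  | App3 f t1 t2 t3 => App3 f (tsubst s v t1) (tsubst s v t2) (tsubst s v t3)
  end.

Fixpoint fsubst (s : term) (v : nat) (phi : formula) : formula :=
  match phi with
  | Eq t1 t2 => Eq (tsubst s v t1) (tsubst s v t2)
  | Tr t => Tr (tsubst s v t)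
  | Neg phi => Neg (fsubst s v phi)
  | And phi psi => And (fsubst s v phi) (fsubst s v psi)
  | Or phi psi => Or (fsubst s v phi) (fsubst s v psi)
  | All w phi => All w (if v =? w then phi else fsubst s v phi)
  | Ex w phi => Ex w (if v =? w then phi else fsubst s v phi)
  end.

Fixpoint free_for (s : term) (v : nat) (phi : formula) : bool :=
  match phi with
  | Eq _ _ | Tr _ => true
  | Neg phi => free_for s v phi
  | And phi psi | Or phi psi => free_for s v phi && free_for s v psi
  | All w phi | Ex w phi =>
      (v =? w) || negb (free v phi) || (negb (occurs w s) && free_for s v phi)
  end.

Definition succ (t : term) : term := App1 Fsucc t.
Definition dneg (t : term) : term := App1 Fneg t.
Definition dTr (t : term) : term := App1 FTr t.
Definition num (t : term) : term := App1 Fnum t.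
Definition add (s t : term) : term := App2 Fadd s t.
Definition mul (s t : term) : term := App2 Fmul s t.
Definition pairt (s t : term) : term := App2 Fpair s t.
Definition dand (s t : term) : term := App2 Fand s t.
Definition dor (s t : term) : term := App2 For s t.
Definition dimp (s t : term) : term := App2 Fimp s t.
Definition dall (v s : term) : term := App2 Fall v s.
Definition dex (v s : term) : term := App2 Fex v s.
Definition sub (s t v : term) : term := App3 Fsub s t v.

Fixpoint numeral (n : nat) : term :=
  match n with 0 => Zero | S n => succ (numeral n) end.

(* Codes are built with Cantor's pairing function:
     <0, n>        the variable number n
     <1, k>        the symbol number k
     <2, <a, b>>   the application of a to b
     <3, <v, b>>   the universal quantification of b over the variable v
     <4, <v, b>>   the existential quantification of b over the variable v *)
Definition npair (a b : nat) : nat := Cantor.to_nat (a, b).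
Definition cvar (n : nat) : nat := npair 0 n.
Definition csym (k : nat) : nat := npair 1 k.
Definition capp (a b : nat) : nat := npair 2 (npair a b).
Definition call (v b : nat) : nat := npair 3 (npair v b).
Definition cex (v b : nat) : nat := npair 4 (npair v b).

Definition sym_zero : nat := 0.
Definition sym_eq : nat := 1.
Definition sym_Tr : nat := 2.
Definition sym_neg : nat := 3.
Definition sym_and : nat := 4.
Definition sym_or : nat := 5.

Definition sym_fun1 (f : fun1) : nat :=
  match f with Fsucc => 6 | Fneg => 7 | FTr => 8 | Fnum => 9 end.

Definition sym_fun2 (f : fun2) : nat :=
  match f with
  | Fadd => 10 | Fmul => 11 | Fpair => 12 | Fand => 13
  | For => 14 | Fimp => 15 | Fall => 16 | Fex => 17
  end.

Definition sym_fun3 (f : fun3) : nat := match f with Fsub => 18 end.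

Fixpoint tcode (t : term) : nat :=
  match t with
  | Var n => cvar n
  | Zero => csym sym_zero
  | App1 f t => capp (csym (sym_fun1 f)) (tcode t)
  | App2 f t1 t2 => capp (capp (csym (sym_fun2 f)) (tcode t1)) (tcode t2)
  | App3 f t1 t2 t3 =>
      capp (capp (capp (csym (sym_fun3 f)) (tcode t1)) (tcode t2)) (tcode t3)
  end.

Definition cneg (a : nat) : nat := capp (csym sym_neg) a.
Definition cTr (a : nat) : nat := capp (csym sym_Tr) a.
Definition cand (a b : nat) : nat := capp (capp (csym sym_and) a) b.
Definition cor (a b : nat) : nat := capp (capp (csym sym_or) a) b.
Definition cimp (a b : nat) : nat := cor (cneg a) b.

Fixpoint code (phi : formula) : nat :=
  match phi with
  | Eq t1 t2 => capp (capp (csym sym_eq) (tcode t1)) (tcode t2)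
  | Tr t => cTr (tcode t)
  | Neg phi => cneg (code phi)
  | And phi psi => cand (code phi) (code psi)
  | Or phi psi => cor (code phi) (code psi)
  | All v phi => call (cvar v) (code phi)
  | Ex v phi => cex (cvar v) (code phi)
  end.

Definition quote (phi : formula) : term := numeral (code phi).

Fixpoint code_list (l : list formula) : nat :=
  match l with
  | [] => 0
  | phi :: l => S (npair (code phi) (code_list l))
  end.

(* Substitution on codes, by course-of-values recursion; both components of a
   pair with nonzero first component are smaller than the pair, so that [n]
   levels of recursion suffice for the argument [n]. *)
Fixpoint csub_rec (fuel n t v : nat) : nat :=
  match fuel with
  | 0 => n
  | S fuel =>
      let (tag, body) := Cantor.of_nat n in
      let (a, b) := Cantor.of_nat body in
      match tag with
      | 0 => if n =? v then t else n
      | 2 => capp (csub_rec fuel a t v) (csub_rec fuel b t v)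
      | 3 => if a =? v then n else call a (csub_rec fuel b t v)
      | 4 => if a =? v then n else cex a (csub_rec fuel b t v)
      | _ => n
      end
  end.

Definition csub (n t v : nat) : nat := csub_rec (S n) n t v.

Definition eval1 (f : fun1) (a : nat) : nat :=
  match f with
  | Fsucc => S a
  | Fneg => cneg a
  | FTr => cTr a
  | Fnum => tcode (numeral a)
  end.

Definition eval2 (f : fun2) (a b : nat) : nat :=
  match f with
  | Fadd => a + b
  | Fmul => a * b
  | Fpair => npair a b
  | Fand => cand a b
  | For => cor a b
  | Fimp => cimp a b
  | Fall => call a b
  | Fex => cex a b
  end.

Definition eval3 (f : fun3) (a b c : nat) : nat :=
  match f with Fsub => csub a b c end.

Fixpoint eval (e : nat -> nat) (t : term) : nat :=
  match t with
  | Var n => e n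
  | Zero => 0
  | App1 f t => eval1 f (eval e t)
  | App2 f t1 t2 => eval2 f (eval e t1) (eval e t2)
  | App3 f t1 t2 t3 => eval3 f (eval e t1) (eval e t2) (eval e t3)
  end.

Definition env0 : nat -> nat := fun _ => 0.

Definition value (t : term) : nat := eval env0 t.

Definition upd (e : nat -> nat) (v n : nat) : nat -> nat :=
  fun w => if w =? v then n else e w.

Fixpoint sat (X : nat -> Prop) (e : nat -> nat) (phi : formula) : Prop :=
  match phi with
  | Eq t1 t2 => eval e t1 = eval e t2
  | Tr t => X (eval e t)
  | Neg phi => ~ sat X e phi
  | And phi psi => sat X e phi /\ sat X e psi
  | Or phi psi => sat X e phi \/ sat X e psi
  | All v phi => forall n, sat X (upd e v n) phi
  | Ex v phi => exists n, sat X (upd e v n) phi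
  end.

Definition theory := formula -> Prop.

(* Open formulas are read as their universal closures. *)
Definition models (X : nat -> Prop) (T : theory) : Prop :=
  forall phi, T phi -> forall e, sat X e phi.

Definition SentSet (n : nat) : Prop :=
  exists phi, sentence phi /\ n = code phi.

Definition antiext (X : nat -> Prop) (n : nat) : Prop :=
  (exists phi, sentence phi /\ n = code phi /\ X (code (Neg phi))) \/
  ~ SentSet n.

(* Strong Kleene evaluation with extension [X] and antiextension [antiext X]:
   [sk X true e phi] says that [phi] is true, [sk X false e phi] that it is
   false. *)
Fixpoint sk (X : nat -> Prop) (b : bool) (e : nat -> nat) (phi : formula)
  : Prop :=
  match phi, b with
  | Eq t1 t2, true => eval e t1 = eval e t2
  | Eq t1 t2, false => eval e t1 <> eval e t2
  | Tr t, true => X (eval e t)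
  | Tr t, false => antiext X (eval e t)
  | Neg phi, _ => sk X (negb b) e phi
  | And phi psi, true | Or phi psi, false => sk X b e phi /\ sk X b e psi
  | And phi psi, false | Or phi psi, true => sk X b e phi \/ sk X b e psi
  | All v phi, true | Ex v phi, false => forall n, sk X b (upd e v n) phi
  | All v phi, false | Ex v phi, true => exists n, sk X b (upd e v n) phi
  end.

Definition sk_true (X : nat -> Prop) (phi : formula) : Prop :=
  sk X true env0 phi.

Definition consistent (X : nat -> Prop) : Prop :=
  ~ exists phi, X (code phi) /\ X (code (Neg phi)).

Fixpoint beval (a : formula -> bool) (phi : formula) : bool :=
  match phi with
  | Neg phi => negb (beval a phi)
  | And phi psi => beval a phi && beval a psi
  | Or phi psi => beval a phi || beval a psi
  | _ => a phi
  end.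

Definition tautology (phi : formula) : Prop :=
  forall a, beval a phi = true.

Inductive logical_axiom : theory :=
| LA_taut phi : tautology phi -> logical_axiom phi
| LA_all_elim v t phi : free_for t v phi = true ->
    logical_axiom (Imp (All v phi) (fsubst t v phi))
| LA_all_intro v phi psi : free v phi = false ->
    logical_axiom (Imp (All v (Imp phi psi)) (Imp phi (All v psi)))
| LA_ex_intro v t phi : free_for t v phi = true ->
    logical_axiom (Imp (fsubst t v phi) (Ex v phi))
| LA_ex_elim v phi psi : free v psi = false ->
    logical_axiom (Imp (All v (Imp phi psi)) (Imp (Ex v phi) psi))
| LA_refl t : logical_axiom (Eq t t)
| LA_leibniz v s t phi : free_for s v phi = true -> free_for t v phi = true ->
    logical_axiom (Imp (Eq s t) (Imp (fsubst s v phi) (fsubst t v phi))).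

(* Derivations are listed with the last line first. *)
Inductive derivation (T : theory) : list formula -> Prop :=
| D_nil : derivation T []
| D_logical phi l :
    logical_axiom phi -> derivation T l -> derivation T (phi :: l)
| D_axiom phi l : T phi -> derivation T l -> derivation T (phi :: l)
| D_mp phi psi l : In psi l -> In (Imp psi phi) l ->
    derivation T l -> derivation T (phi :: l)
| D_gen v phi l : In phi l ->
    derivation T l -> derivation T (All v phi :: l).

Definition provable (T : theory) (phi : formula) : Prop :=
  exists l, derivation T (phi :: l).

Definition tvar (a : term) : term := pairt (numeral 0) a.
Definition tsym (a : term) : term := pairt (numeral 1) a.
Definition tapp (a b : term) : term := pairt (numeral 2) (pairt a b).
Definition tall (a b : term) : term := pairt (numeral 3) (pairt a b).
Definition tex (a b : term) : term := pairt (numeral 4) (pairt a b).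
Definition sym (k : nat) : term := tsym (numeral k).

Section PATsec.

Local Notation x := (Var 0).
Local Notation y := (Var 1).
Local Notation t := (Var 2).
Local Notation v := (Var 3).

Inductive PAT : theory :=
| PA_succ_nonzero : PAT (Neg (Eq (succ x) Zero))
| PA_succ_inj : PAT (Imp (Eq (succ x) (succ y)) (Eq x y))
| PA_add_zero : PAT (Eq (add x Zero) x)
| PA_add_succ : PAT (Eq (add x (succ y)) (succ (add x y)))
| PA_mul_zero : PAT (Eq (mul x Zero) Zero)
| PA_mul_succ : PAT (Eq (mul x (succ y)) (add (mul x y) x))
| PA_induction n phi :
    PAT (Imp (And (fsubst Zero n phi)
                  (All n (Imp phi (fsubst (succ (Var n)) n phi))))
             (All n phi))
| PA_pair :
    PAT (Eq (mul (pairt x y) (numeral 2))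
            (add (mul y (numeral 2)) (mul (add y x) (succ (add y x)))))
| PA_neg : PAT (Eq (dneg x) (tapp (sym sym_neg) x))
| PA_Tr : PAT (Eq (dTr x) (tapp (sym sym_Tr) x))
| PA_and : PAT (Eq (dand x y) (tapp (tapp (sym sym_and) x) y))
| PA_or : PAT (Eq (dor x y) (tapp (tapp (sym sym_or) x) y))
| PA_imp : PAT (Eq (dimp x y) (dor (dneg x) y))
| PA_all : PAT (Eq (dall x y) (tall x y))
| PA_ex : PAT (Eq (dex x y) (tex x y))
| PA_num_zero : PAT (Eq (num Zero) (sym sym_zero))
| PA_num_succ :
    PAT (Eq (num (succ x)) (tapp (sym (sym_fun1 Fsucc)) (num x)))
| PA_sub_var_eq : PAT (Eq (sub (tvar x) t (tvar x)) t)
| PA_sub_var_neq :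
    PAT (Imp (Neg (Eq (tvar x) v)) (Eq (sub (tvar x) t v) (tvar x)))
| PA_sub_sym : PAT (Eq (sub (tsym x) t v) (tsym x))
| PA_sub_app : PAT (Eq (sub (tapp x y) t v) (tapp (sub x t v) (sub y t v)))
| PA_sub_all_eq : PAT (Eq (sub (tall v y) t v) (tall v y))
| PA_sub_all_neq :
    PAT (Imp (Neg (Eq x v)) (Eq (sub (tall x y) t v) (tall x (sub y t v))))
| PA_sub_ex_eq : PAT (Eq (sub (tex v y) t v) (tex v y))
| PA_sub_ex_neq :
    PAT (Imp (Neg (Eq x v)) (Eq (sub (tex x y) t v) (tex x (sub y t v))))
| PA_sub_other :
    PAT (Eq (sub (pairt (add x (numeral 5)) y) t v)
            (pairt (add x (numeral 5)) y)).

End PATsec.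

Definition SSK (X : nat -> Prop) (n : nat) : Prop :=
  exists phi psi, sentence phi /\ sentence psi /\ n = code phi /\
    sk_true X psi /\ provable PAT (Imp psi phi).

Definition ClTermSet (n : nat) : Prop :=
  exists t, closed t /\ n = tcode t.

Definition ValRel (n m : nat) : Prop :=
  exists t, closed t /\ n = tcode t /\ m = value t.

Definition True0Set (n : nat) : Prop :=
  exists s t, closed s /\ closed t /\
    ((n = code (Eq s t) /\ value s = value t) \/
     (n = code (Neg (Eq s t)) /\ value s <> value t)).

(* [ProofRel n p]: [p] codes a derivation in PAT of the sentence coded by
   [n]. *)
Definition ProofRel (n p : nat) : Prop :=
  exists phi l, sentence phi /\ n = code phi /\ p = code_list (phi :: l) /\
    derivation PAT (phi :: l).

Definition represents1 (A : formula) (P : nat -> Prop) : Prop :=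
  arithmetical A = true /\
  (forall v, free v A = true -> v = 0) /\
  forall n,
    (P n -> provable PAT (fsubst (numeral n) 0 A)) /\
    (~ P n -> provable PAT (Neg (fsubst (numeral n) 0 A))).

(* The first argument is the variable 0, the second one the variable 1. *)
Definition represents2 (A : formula) (P : nat -> nat -> Prop) : Prop :=
  arithmetical A = true /\
  (forall v, free v A = true -> v = 0 \/ v = 1) /\
  forall n m,
    let Anm := fsubst (numeral m) 1 (fsubst (numeral n) 0 A) in
    (P n m -> provable PAT Anm) /\ (~ P n m -> provable PAT (Neg Anm)).

(* Any [Tr]-free formulas numeralwise representing the syntactic notions in
   PAT. *)
Record arithmetization := {
  Sent : formula;
  ClTerm : formula;
  Val : formula;
  True0 : formula;
  Proof_PAT : formula;
  Sent_rep : represents1 Sent SentSet;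
  ClTerm_rep : represents1 ClTerm ClTermSet;
  Val_rep : represents2 Val ValRel;
  True0_rep : represents1 True0 True0Set;
  Proof_PAT_rep : represents2 Proof_PAT ProofRel
}.

(* Free variable: 0. *)
Definition Pr_PAT (A : arithmetization) : formula := Ex 1 (Proof_PAT A).

(* [A(t)] and [A(s,t)], avoiding capture by the bound variables of [A]; the
   terms must not contain the variables 0 and 1. *)
Definition app1 (A : formula) (t : term) : formula :=
  Ex 0 (And (Eq (Var 0) t) A).
Definition app2 (A : formula) (s t : term) : formula :=
  Ex 0 (Ex 1 (And (Eq (Var 0) s) (And (Eq (Var 1) t) A))).

Fixpoint disj (phi : formula) (l : list formula) : formula :=
  match l with [] => phi | psi :: l => Or phi (disj psi l) end.

Section Pi.

Variables (A : arithmetization) (pi : formula).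

(* Its value is the code of [pi] applied to the numeral of the value of [s]. *)
Definition pi_dot (s : term) : term :=
  sub (quote pi) (num s) (numeral (cvar 0)).

Definition pi_body : formula :=
  let x := Var 0 in
  let y := Var 2 in let z := Var 3 in let v := Var 4 in
  let t := Var 5 in let u := Var 6 in let k := Var 7 in
  let T s := Tr (pi_dot s) in
  let ex_t phi := Ex 5 (And (app1 (ClTerm A) t) phi) in
  let all_t phi := All 5 (Imp (app1 (ClTerm A) t) phi) in
  (* phi holds of u, the value of t *)
  let at_val phi := Ex 6 (And (app2 (Val A) t u) phi) in
  let ex_y phi := Ex 2 phi in
  let ex_yz phi := Ex 2 (Ex 3 phi) in
  let ex_yv phi :=
    Ex 2 (Ex 4 (And (Ex 7 (Eq v (pairt (numeral 0) k))) phi)) in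
  disj (True0 A)
  [ ex_t (And (Eq x (dTr t)) (at_val (Tr u)));
    ex_t (And (Eq x (dneg (dTr t)))
              (at_val (Or (Tr (dneg u)) (Neg (app1 (Sent A) u)))));
    ex_y (And (Eq x (dneg (dneg y))) (T y));
    ex_yz (And (Eq x (dand y z)) (And (T y) (T z)));
    ex_yz (And (Eq x (dneg (dand y z))) (Or (T (dneg y)) (T (dneg z))));
    ex_yz (And (Eq x (dor y z)) (Or (T y) (T z)));
    ex_yz (And (Eq x (dneg (dor y z))) (And (T (dneg y)) (T (dneg z))));
    ex_yv (And (Eq x (dall v y)) (all_t (T (sub y t v))));
    ex_yv (And (Eq x (dneg (dall v y))) (ex_t (T (dneg (sub y t v)))));
    ex_yv (And (Eq x (dex v y)) (ex_t (T (sub y t v))));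
    ex_yv (And (Eq x (dneg (dex v y))) (all_t (T (dneg (sub y t v))))) ].

Definition is_pi : Prop :=
  (forall v, free v pi = true -> v = 0) /\
  provable PAT (All 0 (Iff pi pi_body)).

Definition TBpi : formula := All 0 (Iff (Tr (pi_dot (Var 0))) pi).

Definition PK_Tr : formula :=
  let x := Var 2 in let y := Var 3 in
  All 2 (Iff (Tr x) (Ex 3 (And (app1 pi y) (app1 (Pr_PAT A) (dimp y x))))).

Inductive PK : theory :=
| PK_PAT phi : PAT phi -> PK phi
| PK_TBpi : PK TBpi
| PK_PK_Tr : PK PK_Tr.

End Pi.

(* Main.v *)
From Stdlib Require Import Arith Bool List Cantor Lia Classical ClassicalEpsilon.
Require Import Defs.
Import ListNotations.

(** Unfolding [pi] in (N, X) gives an inductive clause over the codes of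
    sentences that mirrors Strong Kleene evaluation, and (TBpi) says exactly that
    [n |-> X (code (pi n))] is a fixed point of this clause. By induction on the
    size of a sentence, every such fixed point coincides on sentences with Strong
    Kleene truth, so under (TBpi) the axiom (PK-Tr) says precisely that
    [SSK X = X]. It remains to derive (TBpi) from [SSK X = X]: one direction is
    the soundness of PAT together with the consistency of [X]; for the other,
    [pi_body] is positive in [Tr], so that its classical truth implies its Strong
    Kleene truth, and PAT proves that [pi_body] implies [pi]. *)

Arguments npair : simpl never.
Arguments csub : simpl never.

(** * Pairing, environments and their dependence on free variables *)

Lemma npair_inj a b c d : npair a b = npair c d -> a = c /\ b = d.
Proof.
  intros H; unfold npair in H; apply to_nat_inj in H; now inversion H.
Qed.

Lemma of_nat_npair a b : Cantor.of_nat (npair a b) = (a, b).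
Proof. apply cancel_of_to. Qed.

Lemma npair_ge a b : a + b <= npair a b.
Proof. unfold npair. pose proof (to_nat_non_decreasing a b); lia. Qed.

Lemma upd_eq e v n : upd e v n v = n.
Proof. unfold upd; now rewrite Nat.eqb_refl. Qed.

Lemma upd_neq e v n w : w <> v -> upd e v n w = e w.
Proof. intros H; unfold upd. now apply Nat.eqb_neq in H as ->. Qed.

Lemma eval_ext e e' t :
  (forall v, occurs v t = true -> e v = e' v) -> eval e t = eval e' t.
Proof.
  induction t; simpl; intros H.
  1: apply H, Nat.eqb_refl.
  all: f_equal; auto;
    match goal with IH : _ -> ?g |- ?g => apply IH end;
    intros w Hw; apply H; rewrite Hw; now rewrite ?orb_true_r.
Qed.

Lemma eval_upd_fresh e v n t : occurs v t = false -> eval (upd e v n) t = eval e t.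
Proof.
  intros H; apply eval_ext; intros w Hw; apply upd_neq; congruence.
Qed.

Lemma occurs_numeral v n : occurs v (numeral n) = false.
Proof. induction n; simpl; auto. Qed.

Lemma eval_numeral e n : eval e (numeral n) = n.
Proof. induction n; simpl; auto. Qed.

Lemma free_quant (v w : nat) phi :
  free v phi = true -> v <> w -> negb (v =? w) && free v phi = true.
Proof. intros -> H. apply Nat.eqb_neq in H as ->. reflexivity. Qed.

Lemma upd_agree e e' w n phi :
  (forall v, negb (v =? w) && free v phi = true -> e v = e' v) ->
  forall v, free v phi = true -> upd e w n v = upd e' w n v.
Proof.
  intros H v Hv. destruct (Nat.eq_dec v w) as [->|Hn].
  - now rewrite !upd_eq.
  - rewrite !upd_neq by assumption. apply H. now apply free_quant.
Qed.

Lemma sat_ext X phi : forall e e',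
  (forall v, free v phi = true -> e v = e' v) -> sat X e phi <-> sat X e' phi.
Proof.
  induction phi; simpl; intros e e' H.
  1: rewrite (eval_ext e e' t1), (eval_ext e e' t2); [reflexivity | |];
     intros w Hw; apply H; rewrite Hw; now rewrite ?orb_true_r.
  1: rewrite (eval_ext e e' t); [reflexivity | assumption].
  1: now rewrite (IHphi e e').
  1, 2: rewrite (IHphi1 e e'), (IHphi2 e e'); [reflexivity | |];
     intros w Hw; apply H; rewrite Hw; now rewrite ?orb_true_r.
  all: assert (E : forall n, sat X (upd e v n) phi <-> sat X (upd e' v n) phi)
     by (intros n; apply IHphi, upd_agree, H);
     now setoid_rewrite E.
Qed.

Lemma sk_ext X phi : forall b e e',
  (forall v, free v phi = true -> e v = e' v) -> sk X b e phi <-> sk X b e' phi.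
Proof.
  induction phi; simpl; intros b e e' H.
  1: rewrite (eval_ext e e' t1), (eval_ext e e' t2); [reflexivity | |];
     intros w Hw; apply H; rewrite Hw; now rewrite ?orb_true_r.
  1: rewrite (eval_ext e e' t); [reflexivity | assumption].
  1: now apply IHphi.
  1, 2: destruct b; rewrite (IHphi1 _ e e'), (IHphi2 _ e e'); try reflexivity;
     intros w Hw; apply H; rewrite Hw; now rewrite ?orb_true_r.
  all: assert (E : forall n, sk X b (upd e v n) phi <-> sk X b (upd e' v n) phi)
     by (intros n; apply IHphi, upd_agree, H);
     destruct b; now setoid_rewrite E.
Qed.

Lemma sat_upd_fresh X phi e v n :
  free v phi = false -> sat X (upd e v n) phi <-> sat X e phi.
Proof. intros H; apply sat_ext; intros w Hw; apply upd_neq; congruence. Qed.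

(** * Substitution lemmas for classical and Strong Kleene evaluation *)

Lemma tsubst_fresh s v t : occurs v t = false -> tsubst s v t = t.
Proof.
  induction t; simpl; intros H; rewrite ?orb_false_iff in H; f_equal; intuition.
  now rewrite H.
Qed.

Lemma fsubst_fresh s v phi : free v phi = false -> fsubst s v phi = phi.
Proof.
  induction phi; simpl; intros H; rewrite ?orb_false_iff in H.
  1, 2: f_equal; intuition auto using tsubst_fresh.
  1, 2, 3: f_equal; intuition.
  all: destruct (v =? v0); simpl in H; f_equal; auto.
Qed.

Lemma eval_tsubst e s v t :
  eval e (tsubst s v t) = eval (upd e v (eval e s)) t.
Proof.
  induction t; simpl; try congruence.
  unfold upd. rewrite (Nat.eqb_sym n v). now destruct (v =? n).
Qed.

(* The quantifier step of the substitution lemma, common to [sat] and [sk]. *)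
Lemma subst_quant (Q : formula -> (nat -> nat) -> Prop) s v w phi :
  (forall e e', (forall v, free v phi = true -> e v = e' v) ->
     Q phi e <-> Q phi e') ->
  (free_for s v phi = true ->
     forall e, Q (fsubst s v phi) e <-> Q phi (upd e v (eval e s))) ->
  free_for s v (All w phi) = true ->
  forall e n, Q (if v =? w then phi else fsubst s v phi) (upd e w n) <->
              Q phi (upd (upd e v (eval e s)) w n).
Proof.
  simpl; intros Hext IH Hff e n.
  destruct (Nat.eqb_spec v w) as [->|Hn].
  - apply Hext; intros u _; unfold upd; now destruct (u =? w).
  - simpl in Hff. apply orb_prop in Hff as [Hff|Hff].
    + apply negb_true_iff in Hff. rewrite fsubst_fresh by assumption.
      apply Hext; intros u Hu; unfold upd; destruct (u =? w); auto.
      destruct (Nat.eqb_spec u v); congruence.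
    + apply andb_prop in Hff as [Ho Hff]. apply negb_true_iff in Ho.
      rewrite IH, eval_upd_fresh by assumption.
      apply Hext; intros u _; unfold upd.
      destruct (Nat.eqb_spec u w), (Nat.eqb_spec u v); congruence.
Qed.

Lemma sat_fsubst X s v phi : free_for s v phi = true ->
  forall e, sat X e (fsubst s v phi) <-> sat X (upd e v (eval e s)) phi.
Proof.
  induction phi; simpl; intros Hff e; rewrite ?eval_tsubst; try reflexivity.
  1: now rewrite IHphi.
  1, 2: apply andb_prop in Hff as [H1 H2]; now rewrite IHphi1, IHphi2.
  all: pose proof (subst_quant (fun phi e => sat X e phi) s v v0 phi
         (sat_ext X phi) IHphi Hff e) as E; simpl in E; now setoid_rewrite E.
Qed.

Lemma sk_fsubst X s v phi : free_for s v phi = true ->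
  forall b e, sk X b e (fsubst s v phi) <-> sk X b (upd e v (eval e s)) phi.
Proof.
  induction phi; simpl; intros Hff b e; rewrite ?eval_tsubst; try reflexivity.
  1: now rewrite IHphi.
  1, 2: apply andb_prop in Hff as [H1 H2]; destruct b; now rewrite IHphi1, IHphi2.
  all: pose proof (subst_quant (fun phi e => sk X b e phi) s v v0 phi
         (sk_ext X phi b) (fun H => IHphi H b) Hff e) as E; simpl in E;
       destruct b; now setoid_rewrite E.
Qed.

Lemma free_for_closed s v phi : closed s -> free_for s v phi = true.
Proof.
  intros H; induction phi; simpl; auto using andb_true_intro;
    rewrite H, IHphi; apply orb_true_r.
Qed.

Lemma free_for_numeral n v phi : free_for (numeral n) v phi = true.
Proof. apply free_for_closed; intros w; apply occurs_numeral. Qed.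

(** The only variable of the substituted term is [v]; a quantifier that could capture it binds [v]
    itself, and substitution stops there. The induction axiom needs this case. *)
Lemma free_for_succ v phi : free_for (succ (Var v)) v phi = true.
Proof.
  induction phi; simpl; auto using andb_true_intro;
    rewrite IHphi, andb_true_r, (Nat.eqb_sym v0 v); now destruct (v =? v0), (free v phi).
Qed.

Lemma sat_numeral X n v phi e :
  sat X e (fsubst (numeral n) v phi) <-> sat X (upd e v n) phi.
Proof.
  rewrite sat_fsubst by apply free_for_numeral. now rewrite eval_numeral.
Qed.

Lemma occurs_tsubst s v w t : closed s ->
  occurs w (tsubst s v t) = true -> w <> v /\ occurs w t = true.
Proof.
  intros Hs; induction t; simpl; rewrite ?orb_true_iff; try tauto.
  2: discriminate.
  destruct (Nat.eqb_spec v n) as [->|Hn]; [now rewrite Hs|].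
  simpl. rewrite Nat.eqb_eq. intros ->; split; auto.
Qed.

Lemma free_fsubst s v w phi : closed s ->
  free w (fsubst s v phi) = true -> w <> v /\ free w phi = true.
Proof.
  intros Hs; induction phi; simpl; rewrite ?orb_true_iff, ?andb_true_iff; try tauto.
  1: intros [H|H]; apply occurs_tsubst in H; tauto.
  1: apply occurs_tsubst; assumption.
  all: destruct (Nat.eqb_spec v v0) as [->|]; [|tauto];
       rewrite negb_true_iff, Nat.eqb_neq; tauto.
Qed.

Lemma sentence_fsubst s v phi : closed s ->
  (forall w, free w phi = true -> w = v) -> sentence (fsubst s v phi).
Proof.
  intros Hs H w. destruct (free w (fsubst s v phi)) eqn:E; auto.
  apply free_fsubst in E as [E1 E2]; auto. now apply H in E2.
Qed.

Lemma closed_numeral n : closed (numeral n).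
Proof. intros v; apply occurs_numeral. Qed.

Lemma sat_imp X e phi psi :
  sat X e (Imp phi psi) <-> (sat X e phi -> sat X e psi).
Proof. simpl. destruct (classic (sat X e phi)); tauto. Qed.

Lemma sat_iff X e phi psi :
  sat X e (Iff phi psi) <-> (sat X e phi <-> sat X e psi).
Proof.
  change (sat X e (Iff phi psi))
    with (sat X e (Imp phi psi) /\ sat X e (Imp psi phi)).
  now rewrite !sat_imp.
Qed.

(** * Substitution on codes and injectivity of the coding *)

Lemma csub_rec_fuel t v : forall f g n, n < f -> n < g ->
  csub_rec f n t v = csub_rec g n t v.
Proof.
  induction f as [|f IH]; intros g n Hf Hg; [lia|].
  destruct g as [|g]; [lia|]. simpl.
  destruct (Cantor.of_nat n) as [tag body] eqn:E.
  destruct (Cantor.of_nat body) as [a b] eqn:E'.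
  assert (En : n = npair tag body) by (unfold npair; now rewrite <- E, cancel_to_of).
  assert (Eb : body = npair a b) by (unfold npair; now rewrite <- E', cancel_to_of).
  pose proof (npair_ge tag body). pose proof (npair_ge a b).
  (* Recursive calls occur only under the tags 2, 3 and 4. Since a pair is at least the sum of its
     components, a positive tag makes [body], and hence [a] and [b], strictly smaller than [n], so
     the fuel left is still enough. *)
  destruct tag as [|[|[|[|[|]]]]]; auto;
    rewrite !(IH g) by lia; reflexivity.
Qed.

(** Independence of the fuel turns the definition into a genuine recursion equation, from which each
    shape of code gets its own rewrite rule. *)
Lemma csub_eq n t v : csub n t v =
  let (tag, body) := Cantor.of_nat n in
  let (a, b) := Cantor.of_nat body in
  match tag with
  | 0 => if n =? v then t else n
  | 2 => capp (csub a t v) (csub b t v)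
  | 3 => if a =? v then n else call a (csub b t v)
  | 4 => if a =? v then n else cex a (csub b t v)
  | _ => n
  end.
Proof.
  unfold csub at 1. cbn [csub_rec].
  destruct (Cantor.of_nat n) as [tag body] eqn:E.
  destruct (Cantor.of_nat body) as [a b] eqn:E'.
  assert (En : n = npair tag body) by (unfold npair; now rewrite <- E, cancel_to_of).
  assert (Eb : body = npair a b) by (unfold npair; now rewrite <- E', cancel_to_of).
  pose proof (npair_ge tag body). pose proof (npair_ge a b).
  unfold csub.
  destruct tag as [|[|[|[|[|]]]]]; auto;
    rewrite ?(csub_rec_fuel t v n (S b) b), ?(csub_rec_fuel t v n (S a) a) by lia;
    reflexivity.
Qed.

Lemma csub_var n t v : csub (cvar n) t v = if cvar n =? v then t else cvar n.
Proof.
  rewrite csub_eq. unfold cvar at 1. rewrite of_nat_npair.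
  now destruct (Cantor.of_nat n).
Qed.

Lemma csub_sym k t v : csub (csym k) t v = csym k.
Proof.
  rewrite csub_eq. unfold csym at 1. rewrite of_nat_npair.
  now destruct (Cantor.of_nat k).
Qed.

Lemma csub_app a b t v : csub (capp a b) t v = capp (csub a t v) (csub b t v).
Proof. rewrite csub_eq. unfold capp at 1. now rewrite !of_nat_npair. Qed.

Lemma csub_all w b t v :
  csub (call w b) t v = if w =? v then call w b else call w (csub b t v).
Proof. rewrite csub_eq. unfold call at 1. now rewrite !of_nat_npair. Qed.

Lemma csub_ex w b t v :
  csub (cex w b) t v = if w =? v then cex w b else cex w (csub b t v).
Proof. rewrite csub_eq. unfold cex at 1. now rewrite !of_nat_npair. Qed.

Lemma csub_other k b t v : csub (npair (k + 5) b) t v = npair (k + 5) b.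
Proof.
  rewrite csub_eq, of_nat_npair. destruct (Cantor.of_nat b) as [x y].
  now rewrite Nat.add_comm.
Qed.

Lemma cvar_eqb v w : (cvar v =? cvar w) = (v =? w).
Proof.
  destruct (Nat.eqb_spec v w) as [->|H]; [apply Nat.eqb_refl|].
  apply Nat.eqb_neq. intros E. now apply npair_inj in E.
Qed.

Lemma csub_tcode s v t : csub (tcode t) (tcode s) (cvar v) = tcode (tsubst s v t).
Proof.
  induction t; simpl; rewrite ?csub_app, ?csub_sym, ?csub_var; try congruence.
  rewrite cvar_eqb, Nat.eqb_sym. now destruct (v =? n).
Qed.

Lemma csub_code s v phi : csub (code phi) (tcode s) (cvar v) = code (fsubst s v phi).
Proof.
  induction phi; simpl; unfold cneg, cTr, cand, cor;
    rewrite ?csub_app, ?csub_sym, ?csub_tcode, ?csub_all, ?csub_ex; try congruence;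
    rewrite cvar_eqb, (Nat.eqb_sym v0 v); destruct (v =? v0); congruence.
Qed.

Ltac code_inv :=
  repeat match goal with
  | H : npair _ _ = npair _ _ |- _ => apply npair_inj in H as [? ?]
  | H : ?a = ?b |- _ =>
      progress unfold cneg, cTr, cand, cor, call, cex, capp, csym, cvar in H
  end;
  try discriminate.

Lemma tcode_inj : forall s t, tcode s = tcode t -> s = t.
Proof.
  induction s; intros [m| |g u|g u1 u2|g u1 u2 u3] E; simpl in E; code_inv;
    f_equal; auto; destruct f, g; reflexivity || discriminate.
Qed.

Lemma code_inj : forall phi psi, code phi = code psi -> phi = psi.
Proof.
  induction phi; intros psi E; destruct psi; simpl in E; code_inv; f_equal;
    auto using tcode_inj.
Qed.

(** * Soundness of PAT in (N, X) for every X *)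

Lemma beval_sat X e phi :
  beval (fun psi => if excluded_middle_informative (sat X e psi) then true else false)
    phi = true <-> sat X e phi.
Proof.
  induction phi; cbn [beval];
    try (destruct excluded_middle_informative; split; easy).
  - rewrite negb_true_iff, <- not_true_iff_false. now apply not_iff_compat.
  - rewrite andb_true_iff. simpl. tauto.
  - rewrite orb_true_iff. simpl. tauto.
Qed.

Lemma logical_axiom_sound X : models X logical_axiom.
Proof.
  intros phi H e; destruct H; rewrite ?sat_imp.
  (* Excluded middle makes satisfaction in [e] a Boolean valuation of formulas, and a tautology is
     true under every valuation. *)
  - apply (beval_sat X e phi), H.
  - intros H1. apply sat_fsubst; auto.
  - intros H1 H2 n. specialize (H1 n). rewrite sat_imp in H1.
    apply H1. now apply sat_upd_fresh.
  - intros H1. rewrite sat_fsubst in H1 by assumption. now exists (eval e t).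
  - intros H1 [n Hn]. specialize (H1 n). rewrite sat_imp in H1.
    apply H1 in Hn. now rewrite sat_upd_fresh in Hn.
  - reflexivity.
  - rewrite !sat_fsubst by assumption. simpl. now intros ->.
Qed.

Lemma derivation_sound X T l : models X T -> derivation T l ->
  forall phi, In phi l -> forall e, sat X e phi.
Proof.
  intros HT; induction 1; simpl; [easy|..]; intros chi [<-|Hc] e; auto.
  - now apply logical_axiom_sound.
  - pose proof (IHderivation _ H0 e) as H2. rewrite sat_imp in H2. auto.
  - intros n. auto.
Qed.

Lemma provable_sound X T phi : models X T -> provable T phi ->
  forall e, sat X e phi.
Proof.
  intros HT [l Hl]. apply (derivation_sound X T _ HT Hl). now left.
Qed.

Lemma PAT_sound X : models X PAT.
Proof.
  intros phi H e; destruct H; rewrite ?sat_imp; cbn -[numeral npair];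
    rewrite ?eval_numeral; try lia.
  - intros [H0 HS] m. rewrite sat_fsubst in H0 by (apply free_for_closed; now intros v).
    (* Induction over the natural numbers themselves applies to any property, so the instances of
       the axiom containing [Tr] hold whatever X is. *)
    induction m as [|m IH]; [exact H0|].
    specialize (HS m). destruct HS as [HS|HS]; [easy|].
    rewrite sat_fsubst in HS by apply free_for_succ. revert HS; apply sat_ext.
    intros w _; simpl. rewrite upd_eq; unfold upd. now destruct (w =? n).
  (* The pairing axiom is Cantor's polynomial multiplied by two, which avoids division. *)
  - apply to_nat_spec.
  - reflexivity.
  - reflexivity.
  - reflexivity.
  - reflexivity.
  - reflexivity.
  - reflexivity.
  - reflexivity.
  - reflexivity.
  - reflexivity.
  - change (csub (cvar (e 0)) (e 2) (cvar (e 0)) = e 2).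
    now rewrite csub_var, Nat.eqb_refl.
  - change (cvar (e 0) <> e 3 -> csub (cvar (e 0)) (e 2) (e 3) = cvar (e 0)).
    intros H. apply Nat.eqb_neq in H. now rewrite csub_var, H.
  - apply csub_sym.
  - apply csub_app.
  - etransitivity; [apply csub_all|]. now rewrite Nat.eqb_refl.
  - intros H. apply Nat.eqb_neq in H. etransitivity; [apply csub_all|]. now rewrite H.
  - etransitivity; [apply csub_ex|]. now rewrite Nat.eqb_refl.
  - intros H. apply Nat.eqb_neq in H. etransitivity; [apply csub_ex|]. now rewrite H.
  - apply csub_other.
Qed.

(** * Truth conditions of the representing formulas and of [pi_body] *)

Lemma sat_represents1 X B P e : represents1 B P -> sat X e B <-> P (e 0).
Proof.
  intros [_ [_ H]]. destruct (H (e 0)) as [H1 H2].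
  assert (E : sat X e (fsubst (numeral (e 0)) 0 B) <-> sat X e B).
  { rewrite sat_numeral. apply sat_ext. intros w _; unfold upd.
    now destruct (Nat.eqb_spec w 0) as [->|]. }
  (* PAT decides each numerical instance in accordance with [P], and soundness carries its verdict
     over to (N, X). *)
  destruct (classic (P (e 0))) as [HP|HP].
  - apply H1 in HP as Hs. apply (provable_sound X _ _ (PAT_sound X)) with (e := e) in Hs.
    tauto.
  - apply H2 in HP as Hs. apply (provable_sound X _ _ (PAT_sound X)) with (e := e) in Hs.
    simpl in Hs. tauto.
Qed.

Lemma sat_represents2 X B P e : represents2 B P -> sat X e B <-> P (e 0) (e 1).
Proof.
  intros [_ [_ H]]. destruct (H (e 0) (e 1)) as [H1 H2].
  assert (E : sat X e (fsubst (numeral (e 1)) 1 (fsubst (numeral (e 0)) 0 B)) <->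
              sat X e B).
  { rewrite !sat_numeral. apply sat_ext. intros w _; unfold upd.
    destruct (Nat.eqb_spec w 0) as [->|]; auto.
    now destruct (Nat.eqb_spec w 1) as [->|]. }
  destruct (classic (P (e 0) (e 1))) as [HP|HP].
  - apply H1 in HP as Hs. apply (provable_sound X _ _ (PAT_sound X)) with (e := e) in Hs.
    tauto.
  - apply H2 in HP as Hs. apply (provable_sound X _ _ (PAT_sound X)) with (e := e) in Hs.
    simpl in Hs. tauto.
Qed.

Lemma sat_app1 X e B t : occurs 0 t = false ->
  sat X e (app1 B t) <-> sat X (upd e 0 (eval e t)) B.
Proof.
  intros Ht; unfold app1; cbn [sat eval]. setoid_rewrite upd_eq.
  setoid_rewrite (eval_upd_fresh e 0 _ t Ht).
  split; [now intros (n & -> & H) | eauto].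
Qed.

Lemma sat_app2 X e B s t :
  occurs 0 s = false -> occurs 1 s = false ->
  occurs 0 t = false -> occurs 1 t = false ->
  sat X e (app2 B s t) <-> sat X (upd (upd e 0 (eval e s)) 1 (eval e t)) B.
Proof.
  intros Hs0 Hs1 Ht0 Ht1; unfold app2; cbn [sat eval].
  setoid_rewrite upd_eq. setoid_rewrite upd_neq; [|easy].
  setoid_rewrite upd_eq.
  setoid_rewrite (fun n m => eval_upd_fresh (upd e 0 n) 1 m s Hs1).
  setoid_rewrite (fun n m => eval_upd_fresh (upd e 0 n) 1 m t Ht1).
  setoid_rewrite (fun n => eval_upd_fresh e 0 n s Hs0).
  setoid_rewrite (fun n => eval_upd_fresh e 0 n t Ht0).
  split; [now intros (n & m & -> & -> & H) | eauto].
Qed.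

Lemma eval_pi_dot pi e s :
  eval e (pi_dot pi s) = code (fsubst (numeral (eval e s)) 0 pi).
Proof.
  change (csub (eval e (quote pi)) (tcode (numeral (eval e s)))
               (eval e (numeral (cvar 0))) = code (fsubst (numeral (eval e s)) 0 pi)).
  unfold quote. rewrite !eval_numeral. apply csub_code.
Qed.

(** [P] stands for the set of n with X (code (pi n)). Keeping it apart from [X] makes (TBpi) a fixed
    point equation for [P]: X itself is consulted only at the literals [Tr t] and their
    negations. *)
Inductive pi_clause (X P : nat -> Prop) : nat -> Prop :=
| pi_true0 n : True0Set n -> pi_clause X P n
| pi_tr t : closed t -> X (value t) -> pi_clause X P (cTr (tcode t))
| pi_ntr t : closed t -> X (cneg (value t)) \/ ~ SentSet (value t) ->
    pi_clause X P (cneg (cTr (tcode t)))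
| pi_nneg y : P y -> pi_clause X P (cneg (cneg y))
| pi_and y z : P y -> P z -> pi_clause X P (cand y z)
| pi_nand y z : P (cneg y) \/ P (cneg z) -> pi_clause X P (cneg (cand y z))
| pi_or y z : P y \/ P z -> pi_clause X P (cor y z)
| pi_nor y z : P (cneg y) -> P (cneg z) -> pi_clause X P (cneg (cor y z))
| pi_all v y : (forall t, closed t -> P (csub y (tcode t) (cvar v))) ->
    pi_clause X P (call (cvar v) y)
| pi_nall v y t : closed t -> P (cneg (csub y (tcode t) (cvar v))) ->
    pi_clause X P (cneg (call (cvar v) y))
| pi_ex v y t : closed t -> P (csub y (tcode t) (cvar v)) ->
    pi_clause X P (cex (cvar v) y)
| pi_nex v y : (forall t, closed t -> P (cneg (csub y (tcode t) (cvar v)))) ->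
    pi_clause X P (cneg (cex (cvar v) y)).

Lemma sat_pi_body A pi X e :
  sat X e (pi_body A pi) <->
  pi_clause X (fun n => X (code (fsubst (numeral n) 0 pi))) (e 0).
Proof.
  unfold pi_body; cbn [sat disj].
  (* The representing formulas are first replaced by the sets they represent; afterwards the
     statement depends on [e] only through [e 0]. *)
  assert (E1 : forall e, sat X e (app1 (ClTerm A) (Var 5)) <-> ClTermSet (e 5)).
  { intros e'. rewrite sat_app1 by easy.
    now rewrite (sat_represents1 _ _ _ _ (ClTerm_rep A)), upd_eq. }
  assert (E2 : forall e, sat X e (app1 (Sent A) (Var 6)) <-> SentSet (e 6)).
  { intros e'. rewrite sat_app1 by easy.
    now rewrite (sat_represents1 _ _ _ _ (Sent_rep A)), upd_eq. }
  assert (E3 : forall e, sat X e (app2 (Val A) (Var 5) (Var 6)) <-> ValRel (e 5) (e 6)).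
  { intros e'. rewrite sat_app2 by easy.
    now rewrite (sat_represents2 _ _ _ _ (Val_rep A)). }
  setoid_rewrite sat_imp. cbn [sat].
  setoid_rewrite E1. setoid_rewrite E2. setoid_rewrite E3.
  setoid_rewrite eval_pi_dot.
  rewrite (sat_represents1 _ _ _ _ (True0_rep A)).
  clear E1 E2 E3.
  cbn [eval eval1 eval2 eval3 upd Nat.eqb numeral dneg dTr dand dor dall dex sub pairt].
  generalize (e 0) as m; clear; intros m. split.
  - intros H. decompose [or and ex] H; clear H; subst;
      repeat match goal with
      | H : ClTermSet _ |- _ => destruct H as (? & ? & ->)
      | H : ValRel _ _ |- _ =>
          destruct H as (? & ? & H & ->); apply tcode_inj in H as ->
      end.
    1: now apply pi_true0.
    all: first
      [ eapply pi_tr | eapply pi_ntr | eapply pi_nneg | eapply pi_and | eapply pi_nand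
      | eapply pi_or | eapply pi_nor | eapply pi_all | eapply pi_nall | eapply pi_ex
      | eapply pi_nex ]; try (intros s Hs); eauto;
      match goal with H : forall n, ClTermSet n -> _ |- _ => apply H; now exists s end.
  - intros [].
    + now left.
    + right; left. exists (tcode t). split; [now exists t|]. split; [easy|].
      exists (value t). split; [now exists t | assumption].
    + do 2 right; left. exists (tcode t). split; [now exists t|]. split; [easy|].
      exists (value t). split; [now exists t | assumption].
    + do 3 right; left; eauto.
    + do 4 right; left; eauto.
    + do 5 right; left; eauto.
    + do 6 right; left; eauto.
    + do 7 right; left; eauto.
    + do 8 right; left. exists y, (cvar v). split; [now exists v|]. split; [easy|].
      intros n (t & Ht & ->); auto.
    + do 9 right; left. exists y, (cvar v). split; [now exists v|]. split; [easy|].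
      exists (tcode t). split; [now exists t | assumption].
    + do 10 right; left. exists y, (cvar v). split; [now exists v|]. split; [easy|].
      exists (tcode t). split; [now exists t | assumption].
    + do 11 right. exists y, (cvar v). split; [now exists v|]. split; [easy|].
      intros n (t & Ht & ->); auto.
Qed.

(** * Strong Kleene truth compared with classical truth *)

Lemma sk_sat X : (forall n, X n -> SentSet n) -> consistent X ->
  forall phi b e, sk X b e phi -> if b then sat X e phi else ~ sat X e phi.
Proof.
  intros HX Hc; induction phi; intros b e H.
  - now destruct b.
  (* A false [Tr t] has its value in the antiextension. Were that value also in X, then either X
     would contain a sentence with its negation, or X would contain a code of no sentence. *)
  - destruct b; [exact H|]. destruct H as [(phi & _ & E & H)|H]; [|intros H'; auto].
    intros H'. apply Hc. exists phi. now rewrite <- E.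
  - pose proof (IHphi (negb b) e H). destruct b; simpl in *; tauto.
  - pose proof (IHphi1 b e). pose proof (IHphi2 b e). destruct b; simpl in *; tauto.
  - pose proof (IHphi1 b e). pose proof (IHphi2 b e). destruct b; simpl in *; tauto.
  - destruct b; simpl in *; [intros n; apply (IHphi true), H | intros H'].
    destruct H as [n H]; now apply (IHphi false _ H).
  - destruct b; simpl in *; [|intros [n H']; now apply (IHphi false _ (H n))].
    destruct H as [n H]; exists n; now apply (IHphi true).
Qed.

Lemma sk_arithmetical X phi : arithmetical phi = true -> forall e,
  (sk X true e phi <-> sat X e phi) /\ (sk X false e phi <-> ~ sat X e phi).
Proof.
  induction phi; simpl; rewrite ?andb_true_iff; intros Ha e; try easy.
  - pose proof (IHphi Ha e). destruct (classic (sat X e phi)); tauto.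
  - pose proof (IHphi1 (proj1 Ha) e). pose proof (IHphi2 (proj2 Ha) e).
    destruct (classic (sat X e phi1)); tauto.
  - pose proof (IHphi1 (proj1 Ha) e). pose proof (IHphi2 (proj2 Ha) e). tauto.
  - setoid_rewrite (fun e => proj1 (IHphi Ha e)).
    setoid_rewrite (fun e => proj2 (IHphi Ha e)).
    split; [easy|]. split; [firstorder | apply not_all_ex_not].
  - setoid_rewrite (fun e => proj1 (IHphi Ha e)).
    setoid_rewrite (fun e => proj2 (IHphi Ha e)).
    split; [easy|]. firstorder.
Qed.

(** Negation is allowed only on [Tr]-free formulas, where Strong Kleene evaluation is two-valued.
    This covers the restricted quantifier over closed terms, an implication with [Tr]-free
    antecedent, and the negated [Sent]. *)
Fixpoint positive (phi : formula) : bool :=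
  match phi with
  | Eq _ _ | Tr _ => true
  | Neg phi => arithmetical phi
  | And phi psi | Or phi psi => positive phi && positive psi
  | All _ phi | Ex _ phi => positive phi
  end.

Lemma arithmetical_positive phi : arithmetical phi = true -> positive phi = true.
Proof. induction phi; simpl; rewrite ?andb_true_iff; tauto. Qed.

Lemma sat_positive X phi : positive phi = true ->
  forall e, sat X e phi -> sk X true e phi.
Proof.
  induction phi; simpl; rewrite ?andb_true_iff; intros Hp e H; auto.
  - now apply sk_arithmetical.
  - intuition.
  - intuition.
  - destruct H as [n H]; exists n; auto.
Qed.

Lemma positive_pi_body A pi : positive (pi_body A pi) = true.
Proof.
  assert (H : forall B P, represents1 B P -> arithmetical B = true) by now intros B P [H _].
  pose proof (H _ _ (ClTerm_rep A)) as H1. pose proof (H _ _ (Sent_rep A)) as H2.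
  pose proof (H _ _ (True0_rep A)) as H3.
  assert (H4 : arithmetical (Val A) = true) by now destruct (Val_rep A).
  cbn. rewrite H1, H2, !arithmetical_positive by assumption. reflexivity.
Qed.

Lemma pi_body_free A pi v : free v (pi_body A pi) = true -> v = 0.
Proof.
  assert (H : forall B P, represents1 B P -> forall v, free (S v) B = false).
  { intros B P (_ & H & _) w. specialize (H (S w)).
    destruct (free (S w) B); [now discriminate H | reflexivity]. }
  pose proof (H _ _ (ClTerm_rep A)) as H1. pose proof (H _ _ (Sent_rep A)) as H2.
  pose proof (H _ _ (True0_rep A)) as H3.
  assert (H4 : forall v, free (S (S v)) (Val A) = false).
  { destruct (Val_rep A) as (_ & H4 & _). intros w. specialize (H4 (S (S w))).
    destruct (free (S (S w)) (Val A)); [|reflexivity].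
    now destruct (H4 eq_refl). }
  clear H. unfold pi_body, pi_dot, quote.
  (* The quotation of [pi] is a closed numeral; hiding it behind a variable lets the remaining
     computation of free variables run. *)
  generalize (numeral (code pi)) as c, (occurs_numeral v (code pi)); intros c Hc.
  destruct v as [|[|[|[|[|[|[|[|v]]]]]]]]; [reflexivity|..];
    cbn; rewrite ?H1, ?H2, ?H3, ?H4, ?Hc; cbn; easy.
Qed.

(** * Fixed points of the clause coincide with Strong Kleene truth on sentences *)

Fixpoint size (phi : formula) : nat :=
  match phi with
  | Eq _ _ | Tr _ => 0
  | Neg phi | All _ phi | Ex _ phi => S (size phi)
  | And phi psi | Or phi psi => S (size phi + size psi)
  end.

(** Terms do not contribute to the size, so an instance of a quantified formula is smaller than that
    formula whichever term is inserted. *)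
Lemma size_fsubst s v phi : size (fsubst s v phi) = size phi.
Proof. induction phi; simpl; auto; destruct (v =? v0); auto. Qed.

Lemma sentence_quant_inst v phi s : closed s ->
  (forall w, negb (w =? v) && free w phi = false) -> sentence (fsubst s v phi).
Proof.
  intros Hs H. apply sentence_fsubst; auto. intros w Hw.
  specialize (H w). rewrite Hw, andb_true_r, negb_false_iff in H.
  now apply Nat.eqb_eq.
Qed.

(** This matches the clause for negated [Tr], which speaks of an arbitrary number, with the
    antiextension, which speaks of a sentence. *)
Lemma SentSet_cneg n : SentSet (cneg n) -> exists phi, sentence phi /\ n = code phi.
Proof.
  intros (phi & Hphi & E). destruct phi; simpl in E; code_inv. subst. now exists phi.
Qed.

Lemma sentence_binary phi psi :
  (forall v, free v phi || free v psi = false) -> sentence phi /\ sentence psi.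
Proof. intros H; split; intros v; specialize (H v); now apply orb_false_iff in H. Qed.

(** Injectivity of the coding leaves only the clause whose shape fits the given code; [True0Set] is
    split into its two kinds of literal. *)
Ltac pi_inv H :=
  match type of H with
  | pi_clause _ _ ?c =>
      let m := fresh "m" in let E := fresh "E" in
      remember c as m eqn:E; destruct H as [? (?s & ?t & ? & ? & [[-> ?]|[-> ?]])| | | | | | | | | | |];
      simpl in E; code_inv; subst;
      repeat match goal with
      | H : tcode _ = tcode _ |- _ => apply tcode_inj in H
      | H : code _ = code _ |- _ => apply code_inj in H
      end; subst
  end.

(* A fixed point of the clauses is determined on sentences: they reduce [P] at
   a sentence to [P] at sentences of smaller size, as Strong Kleene evaluation
   does. *)
Lemma pi_clause_sk X P : (forall n, X n -> SentSet n) ->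
  (forall n, P n <-> pi_clause X P n) ->
  forall phi, sentence phi -> P (code phi) <-> sk_true X phi.
Proof.
  intros HX HP.
  enough (H : forall k phi, size phi < k -> sentence phi ->
    P (code phi) <-> sk X true env0 phi) 
    by exact (fun phi => H (S (size phi)) phi (Nat.lt_succ_diag_r _)).
  induction k as [|k IH]; [lia|]. intros phi Hk Hs. rewrite HP.
  (* Substituting a closed term in a code amounts to assigning its value to the variable. This links
     the clauses, which range over closed terms, with Strong Kleene quantifiers, which range over
     numbers. *)
  assert (inst : forall v psi t, S (size psi) <= k ->
    (forall w, negb (w =? v) && free w psi = false) -> closed t ->
    (P (csub (code psi) (tcode t) (cvar v)) <-> sk X true (upd env0 v (value t)) psi)).
  { intros v psi t Hk' Hs' Ht. rewrite csub_code.
    rewrite IH by (rewrite ?size_fsubst; auto using sentence_quant_inst).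
    now rewrite sk_fsubst by now apply free_for_closed. }
  (* The bound is one larger than in [inst], because the induction hypothesis is applied to the
     negated instance. *)
  assert (ninst : forall v psi t, S (S (size psi)) <= k ->
    (forall w, negb (w =? v) && free w psi = false) -> closed t ->
    (P (cneg (csub (code psi) (tcode t) (cvar v))) <->
     sk X false (upd env0 v (value t)) psi)).
  { intros v psi t Hk' Hs' Ht. rewrite csub_code.
    change (cneg (code (fsubst t v psi))) with (code (Neg (fsubst t v psi))).
    rewrite IH; [|simpl; rewrite size_fsubst; lia | now apply sentence_quant_inst].
    cbn [sk negb]. now rewrite sk_fsubst by now apply free_for_closed. }
  assert (neg : forall psi, S (size psi) < k -> sentence psi ->
    (P (cneg (code psi)) <-> sk X false env0 psi)).
  { intros psi Hk' Hs'. now rewrite (IH (Neg psi)). }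
  assert (cl : forall n, closed (numeral n)) by exact closed_numeral.
  (* Every number is the value of a closed term, so quantifying over closed terms misses none. *)
  assert (vl : forall n, value (numeral n) = n) by (intros; apply eval_numeral).
  destruct phi as [s t|t|phi|phi psi|phi psi|v phi|v phi].
  (* [Tr s] is a sentence exactly when [s] is closed, so the lemma on binary connectives also yields
     that both sides of the equation are closed. *)
  - destruct (sentence_binary (Tr s) (Tr t) Hs) as [Hs1 Hs2]. split.
    + intros H; pi_inv H. assumption.
    + intros H. apply pi_true0. exists s, t. auto.
  - split.
    + intros H; pi_inv H. assumption.
    + intros H. now apply pi_tr.
  - destruct phi as [s t|t|phi|phi psi|phi psi|v phi|v phi]; simpl in Hk.
    + destruct (sentence_binary (Tr s) (Tr t) Hs) as [Hs1 Hs2]. split.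
      * intros H; pi_inv H. assumption.
      * intros H. apply pi_true0. exists s, t. auto.
    + split.
      * intros H; pi_inv H. simpl. unfold antiext.
        match goal with D : _ \/ _ |- _ => destruct D as [D|D]; [|now right] end.
        (* X contains only codes of sentences, so a negation in X has the code of a sentence below
           it, as the antiextension demands. *)
        left. destruct (SentSet_cneg _ (HX _ H0)) as (psi & Hpsi & E).
        unfold value in *. rewrite E in *. now exists psi.
      * intros [(psi & Hpsi & E & H)|H]; apply pi_ntr; auto.
        left. unfold value. now rewrite E.
    + split.
      * intros H; pi_inv H. simpl. apply IH; auto; lia.
      * intros H. apply pi_nneg. apply IH; auto; lia.
    + destruct (sentence_binary phi psi Hs) as [Hs1 Hs2]. split.
      * intros H; pi_inv H. simpl. rewrite <- !neg by (auto; lia). assumption.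
      * intros H. apply pi_nand. rewrite !neg by (auto; lia). assumption.
    + destruct (sentence_binary phi psi Hs) as [Hs1 Hs2]. split.
      * intros H; pi_inv H. simpl. rewrite <- !neg by (auto; lia). auto.
      * intros [H1 H2]. apply pi_nor; apply neg; auto; lia.
    + split.
      * intros H; pi_inv H. exists (value t). apply ninst; auto; lia.
      * intros [n H]. apply pi_nall with (numeral n); auto.
        apply ninst; auto; [lia|]. now rewrite vl.
    + split.
      * intros H; pi_inv H. intros n. rewrite <- (vl n). apply ninst; auto; lia.
      * intros H. apply pi_nex. intros t Ht. apply ninst; auto. lia.
  - simpl in Hk. destruct (sentence_binary phi psi Hs) as [Hs1 Hs2]. split.
    + intros H; pi_inv H. split; apply IH; auto; lia.
    + intros [H1 H2]. apply pi_and; apply IH; auto; lia.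
  - simpl in Hk. destruct (sentence_binary phi psi Hs) as [Hs1 Hs2]. split.
    + intros H; pi_inv H. simpl. rewrite <- !IH by (auto; lia). assumption.
    + intros H. apply pi_or. rewrite !IH by (auto; lia). assumption.
  - simpl in Hk. split.
    + intros H; pi_inv H. intros n. rewrite <- (vl n). apply inst; auto; lia.
    + intros H. apply pi_all. intros t Ht. apply inst; auto. lia.
  - simpl in Hk. split.
    + intros H; pi_inv H. exists (value t). apply inst; auto; lia.
    + intros [n H]. apply pi_ex with (numeral n); auto.
      apply inst; auto; [lia|]. now rewrite vl.
Qed.

(** * Derivability, and the truth of (TBpi) and (PK-Tr) in (N, X) *)

Lemma derivation_app T l m : derivation T l -> derivation T m -> derivation T (l ++ m).
Proof.
  intros Hl Hm; induction Hl; simpl; [assumption|..].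
  - now apply D_logical.
  - now apply D_axiom.
  - apply D_mp with psi; rewrite ?in_app_iff; auto.
  - apply D_gen; rewrite ?in_app_iff; auto.
Qed.

Lemma provable_logical T phi : logical_axiom phi -> provable T phi.
Proof. intros H. exists []. apply D_logical; [assumption | constructor]. Qed.

Lemma provable_mp T phi psi :
  provable T phi -> provable T (Imp phi psi) -> provable T psi.
Proof.
  intros [l Hl] [m Hm]. exists ((phi :: l) ++ Imp phi psi :: m).
  apply D_mp with phi; rewrite ?in_app_iff; simpl; auto.
  now apply derivation_app with (l := phi :: l).
Qed.

Lemma provable_inst T v phi n :
  provable T (All v phi) -> provable T (fsubst (numeral n) v phi).
Proof.
  intros H. apply (provable_mp _ _ _ H), provable_logical, LA_all_elim, free_for_numeral.
Qed.

Lemma provable_iff_r T phi psi : provable T (Iff phi psi) -> provable T (Imp psi phi).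
Proof.
  intros H. apply (provable_mp _ _ _ H), provable_logical, LA_taut.
  intros a. simpl. now destruct (beval a phi), (beval a psi).
Qed.

Lemma sat_pi A pi X e n : is_pi A pi ->
  sat X (upd e 0 n) pi <->
  pi_clause X (fun m => X (code (fsubst (numeral m) 0 pi))) n.
Proof.
  intros [_ H]. pose proof (provable_sound X _ _ (PAT_sound X) H e n) as E.
  now rewrite sat_iff, sat_pi_body, upd_eq in E.
Qed.

Lemma sat_TBpi A pi X e : is_pi A pi ->
  let P n := X (code (fsubst (numeral n) 0 pi)) in
  sat X e (TBpi pi) <-> forall n, P n <-> pi_clause X P n.
Proof.
  intros Hpi P.
  assert (E : forall n, sat X (upd e 0 n) (Iff (Tr (pi_dot pi (Var 0))) pi) <->
                        (P n <-> pi_clause X P n)).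
  { intros n. rewrite sat_iff, (sat_pi A pi) by assumption. cbn [sat].
    rewrite eval_pi_dot. cbn [eval]. now rewrite upd_eq. }
  split; intros H n; apply E, H.
Qed.

(** At a fixed point, Strong Kleene truth of the premise becomes [P] at its code, which brings [SSK]
    into the form of the right-hand side of (PK-Tr). *)
Lemma SSK_ProofRel pi X n : (forall m, X m -> SentSet m) ->
  let P m := X (code (fsubst (numeral m) 0 pi)) in
  (forall m, P m <-> pi_clause X P m) ->
  SSK X n <-> exists m, P m /\ exists p, ProofRel (cimp m n) p.
Proof.
  intros HX P HP. split.
  - intros (phi & psi & Hphi & Hpsi & -> & Hsk & l & Hl).
    exists (code psi). split; [now apply (pi_clause_sk X P HX HP)|].
    exists (code_list (Imp psi phi :: l)), (Imp psi phi), l. repeat split; auto.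
    intros v. simpl. now rewrite Hphi, Hpsi.
  (* [P m] alone does not make [m] the code of a sentence; the sentence proved does, since its code
     is an implication from [m] to [n]. *)
  - intros (m & Hm & p & chi & l & Hchi & E & _ & Hl).
    unfold cimp in E. destruct chi as [| | | |chi phi| |]; simpl in E; code_inv.
    destruct chi as [| |psi| | | |]; simpl in *; code_inv. subst.
    destruct (sentence_binary _ _ Hchi) as [Hpsi Hphi].
    exists phi, psi. repeat split; auto; [|now exists l].
    now apply (pi_clause_sk X P HX HP).
Qed.

Lemma sat_PK_Tr A pi X e : is_pi A pi -> (forall m, X m -> SentSet m) ->
  let P m := X (code (fsubst (numeral m) 0 pi)) in
  (forall m, P m <-> pi_clause X P m) ->
  sat X e (PK_Tr A pi) <-> forall n, SSK X n <-> X n.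
Proof.
  intros Hpi HX P HP.
  assert (E : forall n, sat X (upd e 2 n)
      (Iff (Tr (Var 2)) (Ex 3 (And (app1 pi (Var 3))
         (app1 (Pr_PAT A) (dimp (Var 3) (Var 2)))))) <-> (SSK X n <-> X n)).
  { intros n. rewrite sat_iff, (SSK_ProofRel pi X n HX HP). cbn [sat].
    setoid_rewrite (fun e => sat_app1 X e pi (Var 3) eq_refl).
    setoid_rewrite (fun e => sat_app1 X e (Pr_PAT A) (dimp (Var 3) (Var 2)) eq_refl).
    unfold Pr_PAT. cbn [sat].
    setoid_rewrite (sat_represents2 _ _ _ _ (Proof_PAT_rep A)).
    pose proof (fun e k => sat_pi A pi X e k Hpi) as Epi. fold P in Epi.
    setoid_rewrite Epi. setoid_rewrite <- HP.
    cbn [eval eval2 dimp upd Nat.eqb]. split; apply iff_sym. }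
  split; intros H n; apply E, H.
Qed.

Lemma SSK_fixpoint_TBpi A pi X : is_pi A pi ->
  (forall m, X m -> SentSet m) -> consistent X -> (forall n, SSK X n <-> X n) ->
  let P m := X (code (fsubst (numeral m) 0 pi)) in
  forall n, P n <-> pi_clause X P n.
Proof.
  intros Hpi HX Hc Hfix P n. unfold P at 1. rewrite <- Hfix. split.
  - intros (phi & psi & _ & _ & E & Hsk & Hpr). apply code_inj in E as <-.
    apply (sk_sat X HX Hc) in Hsk.
    apply (provable_sound X _ _ (PAT_sound X)) with (e := env0) in Hpr.
    rewrite sat_imp, sat_numeral, (sat_pi A pi) in Hpr by assumption. auto.
  (* The premise witnessing membership in [SSK X] is the body at [n]: it is positive and classically
     true, hence Strong Kleene true, and PAT proves that it implies [pi] at [n]. *)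
  - intros H. exists (fsubst (numeral n) 0 pi), (fsubst (numeral n) 0 (pi_body A pi)).
    assert (Hcl : closed (numeral n)) by apply closed_numeral.
    repeat split.
    + apply sentence_fsubst, Hpi; assumption.
    + apply sentence_fsubst; [assumption | apply pi_body_free].
    + unfold sk_true. rewrite sk_fsubst, eval_numeral by apply free_for_numeral.
      apply sat_positive; [apply positive_pi_body|].
      now rewrite sat_pi_body, upd_eq.
    + apply provable_iff_r. destruct Hpi as [_ Hpr].
      now apply (provable_inst _ _ _ n) in Hpr.
Qed.

Theorem theorem5p5 (A : arithmetization) (pi : formula) (Hpi : is_pi A pi)
  (S : nat -> Prop) (HS : forall n, S n -> SentSet n) (Hcons : consistent S) :
  (forall n, SSK S n <-> S n) <-> models S (PK A pi).
Proof.
  split.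
  - intros Hfix phi H e.
    pose proof (SSK_fixpoint_TBpi A pi S Hpi HS Hcons Hfix) as HP.
    destruct H as [phi H| |].
    + now apply PAT_sound.
    + now apply (sat_TBpi A).
    + now apply sat_PK_Tr.
  (* (PK-Tr) expresses the fixed point property of [SSK] only once (TBpi) is available, so (TBpi) is
     read off the model as well. *)
  - intros H. apply (sat_PK_Tr A pi S env0 Hpi HS).
    + apply (sat_TBpi A pi S env0 Hpi), H, PK_TBpi.
    + apply H, PK_PK_Tr.
Qed.
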